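(* Let $p\ge3$ be a prime and $r>3$ an integer. Then the $p$-group $$C(p,r)=\langle a,b,c\mid a^p=b^p=c^{p^{r-2}}=1,\ [a,b]=c^{p^{r-3}},\ c \text{ central}\rangle$$ is resistant, i.e. for every saturated fusion system $\mathcal F$ over $S=C(p,r)$ one has $N_{\mathcal F}(S)=\mathcal F$.
   Context: $[x,y]=x^{-1}y^{-1}xy$. A fusion system $\mathcal F$ over a finite $p$-group $S$ is a category whose objects are the subgroups of $S$, with $\mathrm{Hom}_S(P,Q)\subseteq \mathrm{Hom}_{\mathcal F}(P,Q)\subseteq \mathrm{Inj}(P,Q)$ (where $\mathrm{Hom}_S(P,Q)$ denotes maps induced by conjugation in $S$), and such that every morphism is an $\mathcal F$-isomorphism followed by an inclusion. $P,Q\le S$ are $\mathcal F$-conjugate if they are isomorphic in $\mathcal F$. $P\le S$ is fully centralized (resp. fully normalized) if $|C_S(P)|\ge|C_S(P')|$ (resp. $|N_S(P)|\ge |N_S(P')|$) for all $P'$ $\mathcal F$-conjugate to $P$. $\mathcal F$ is saturated if (I) every fully normalized $P$ is fully centralized and $\mathrm{Aut}_S(P)\in \mathrm{Syl}_p(\mathrm{Aut}_{\mathcal F}(P))$; (II) if $\varphi\in \mathrm{Hom}_{\mathcal F}(P,S)$ has $\varphi P$ fully centralized, then $\varphi$ extends to a morphism in $\mathrm{Hom}_{\mathcal F}(N_\varphi,S)$, where $N_\varphi=\{g\in N_S(P)\mid \varphi c_g\varphi^{-1}\in \mathrm{Aut}_S(\varphi P)\}$. The condition $N_{\mathcal F}(S)=\mathcal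 F$ means that every $\varphi\in\mathrm{Hom}_{\mathcal F}(Q,Q')$, for all $Q,Q'\le S$, is the restriction of some $\psi\in\mathrm{Aut}_{\mathcal F}(S)$. A $p$-group $S$ is resistant if this holds for every saturated fusion system over $S$. *)

(* Defs.v *)
From mathcomp Require Import all_boot all_fingroup all_solvable.
Set Implicit Arguments.
Unset Strict Implicit.
Unset Printing Implicit Defensive.

Local Open Scope group_scope.

Section Fusion.

Variable gT : finGroupType.
Implicit Types (P Q R S : {group gT}) (f g h : gT -> gT).

Definition Inj P Q f :=
  [/\ morphic P f, {in P &, injective f} & f @: P \subset Q].

Definition HomS S P Q f :=
  exists x, [/\ x \in S, P :^ x \subset Q & {in P, forall y, f y = y ^ x}].

(* A morphism P -> Q is represented by any function gT -> gT having the right *)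
(* values on P; values outside P are irrelevant by fhom_ext.                  *)
Record fusion_system S := FusionSystem {
  fhom : {group gT} -> {group gT} -> pred (gT -> gT);
  fhom_ext : forall P Q f g, {in P, f =1 g} -> fhom P Q f -> fhom P Q g;
  fhom_obj : forall P Q f, fhom P Q f -> P \subset S /\ Q \subset S;
  fhom_HomS : forall P Q f,
    P \subset S -> Q \subset S -> HomS S P Q f -> fhom P Q f;
  fhom_Inj : forall P Q f, fhom P Q f -> Inj P Q f;
  fhom_comp : forall P Q R f g,
    fhom P Q f -> fhom Q R g -> fhom P R (g \o f);
  fhom_factor : forall P Q f, fhom P Q f ->
    exists2 R : {group gT}, R \subset Q &
      fhom P R f /\
      exists2 g, fhom R P g & {in P, cancel f g} /\ {in R, cancel g f}
}.

Variables (S : {group gT}) (F : fusion_system S).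

Definition fconj P Q :=
  exists2 f, fhom F P Q f &
    exists2 g, fhom F Q P g & {in P, cancel f g} /\ {in Q, cancel g f}.

Definition fully_centralized P :=
  P \subset S /\ forall Q, fconj P Q -> #|'C_S(Q)| <= #|'C_S(P)|.

Definition fully_normalized P :=
  P \subset S /\ forall Q, fconj P Q -> #|'N_S(Q)| <= #|'N_S(P)|.

Definition AutS P : {set {perm gT}} := conj_aut P @* 'N_S(P).

Definition AutF P : {set {perm gT}} := [set a in Aut P | fhom F P P a].

(* The group N_f for f with image R: the condition f c_x f^-1 \in Aut_S(R) is *)
(* written as f c_x = a f on P for some a \in Aut_S(R).                       *)
Definition Nphi P R f : {set gT} :=
  [set x in 'N_S(P) |
    [exists a in AutS R, [forall y in P, f (y ^ x) == a (f y)]]].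

Definition saturated (p : nat) :=
  (forall P, fully_normalized P ->
     fully_centralized P /\ p.-Sylow(AutF P) (AutS P)) /\
  (forall P R f, fhom F P S f -> f @: P = R -> fully_centralized R ->
     exists2 N : {group gT}, N = Nphi P R f :> {set gT} &
       exists2 g, fhom F N S g & {in P, g =1 f}).

Definition normalized_by_S :=
  forall Q Q' f, fhom F Q Q' f ->
    exists2 a : {perm gT}, a \in AutF S & {in Q, f =1 a}.

Lemma AutF_group_set P : P \subset S -> group_set (AutF P).
Proof.
move=> sPS; apply/group_setP; split=> [|a b].
  rewrite inE group1; apply: fhom_HomS => //; exists 1.
  by rewrite group1 conjsg1 subxx; split=> // y _; rewrite perm1 conjg1.
rewrite ![_ \in AutF _]in_set => /andP[Aa Fa] /andP[Ab Fb]; rewrite groupM //=.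
by apply: fhom_ext (fhom_comp Fa Fb) => y _; rewrite /= permM.
Qed.

Lemma Nphi_group_set P R f :
  fhom F P S f -> f @: P = R -> group_set (Nphi P R f).
Proof.
move=> Ff fP; apply/group_setP; split=> [|x y].
  rewrite in_set group1; apply/exists_inP; exists 1; first exact: group1.
  by apply/forall_inP=> z _; rewrite conjg1 perm1.
rewrite ![_ \in Nphi _ _ _]in_set.
case/andP=> Nx /exists_inP[a Aa /forall_inP ha].
case/andP=> Ny /exists_inP[b Ab /forall_inP hb].
rewrite groupM //; apply/exists_inP; exists (a * b); first exact: groupM.
apply/forall_inP=> z Pz; have /setIP[_ nPx] := Nx.
by rewrite conjgM permM -(eqP (ha z Pz)) hb ?memJ_norm.
Qed.

End Fusion.

Definition resistant (p : nat) (gT : finGroupType) (S : {group gT}) :=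
  p.-group S /\
  forall F : fusion_system S, saturated F p -> normalized_by_S F.

(* Main.v *)
(* Put z = c^(p^(r-3)) and W = <z>; W is central and contains S'. Since r > 3, *)
(* S / <c^p> is elementary abelian, so every p^(r-3)-th power of S lies in W. *)
(* This makes W invariant under every morphism phi of F whose domain contains *)
(* it. If W <= Q and R = phi(Q), then the automorphisms of R in F that are    *)
(* trivial on R/W and on W form a normal p-subgroup of Aut_F(R), hence lie in *)
(* the Sylow subgroup Aut_S(R); they include phi Aut_S(Q) phi^-1, so N_phi is *)
(* S and phi extends to S. For an arbitrary Q, phi factors through a fully    *)
(* centralized conjugate of Q, and the two isomorphisms onto it first extend  *)
(* to groups containing Z(S), hence W.                                        *)

Require Import Defs.
From mathcomp Require Import all_boot all_fingroup all_solvable.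

Set Implicit Arguments.
Unset Strict Implicit.
Unset Printing Implicit Defensive.

Local Open Scope group_scope.

(** The argument uses only a central element [c] and an exponent [m] such that [z = c ^+ m] is a
    p-element and [W = <[z]>] contains the derived subgroup and all [m]-th powers of S. Being
    generated by a power of a central element, [W] is preserved by every morphism defined on it
    ([fhom_stable_cycle]). Subgroups containing [z] are normal in S, hence fully normalized, and
    their F-automorphisms stabilizing the series 1 <= W <= R come from S ([stabW_sub_AutS]); so
    morphisms defined on [z] extend to S ([fhom_extends_to_S]). [normalized_of_central_cycle]
    reduces any morphism to this case, and [theorem4p2] checks the hypotheses for C(p,r) with
    [m = p ^ (r - 3)]. *)

Section FusionSystemTheory.

Variables (gT : finGroupType) (S : {group gT}) (F : fusion_system S).
Implicit Types (P Q R T : {group gT}) (f g : gT -> gT).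

(** * Morphisms, conjugacy and extension domains in a fusion system *)

Lemma fhom_sub P Q : P \subset Q -> Q \subset S -> fhom F P Q id.
Proof.
move=> sPQ sQS; apply: fhom_HomS => //; first exact: subset_trans sQS.
by exists 1; split=> [||y _]; rewrite ?group1 ?conjsg1 ?conjg1.
Qed.

Lemma fhom_widen P Q R f :
  Q \subset R -> R \subset S -> fhom F P Q f -> fhom F P R f.
Proof. by move=> sQR sRS Ff; apply: fhom_comp Ff (fhom_sub sQR sRS). Qed.

Lemma fhom_restr P Q R f : P \subset Q -> fhom F Q R f -> fhom F P R f.
Proof.
move=> sPQ Ff; have [sQS _] := fhom_obj Ff.
exact: fhom_comp (fhom_sub sPQ sQS) Ff.
Qed.

Lemma fhomM P Q f : fhom F P Q f -> {in P &, {morph f : x y / x * y}}.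
Proof. by case/fhom_Inj=> /morphicP. Qed.

Lemma fhom_inj P Q f : fhom F P Q f -> {in P &, injective f}.
Proof. by case/fhom_Inj. Qed.

Lemma fhom_mem P Q f x : fhom F P Q f -> x \in P -> f x \in Q.
Proof. by case/fhom_Inj=> _ _ /subsetP sfQ Px; rewrite sfQ ?imset_f. Qed.

Lemma fhomX P Q f x n : fhom F P Q f -> x \in P -> f (x ^+ n) = f x ^+ n.
Proof.
case/fhom_Inj=> fM _ _ Px; have /= := morphX (morphm_morphism fM) n Px.
by rewrite morphmE.
Qed.

Lemma fhom_cycle P Q f x :
  fhom F P Q f -> x \in P -> f @: <[x]> = <[f x]>.
Proof.
case/fhom_Inj=> fM _ _ Px; have := morphim_cycle (morphm_morphism fM) Px.
by rewrite morphimEsub ?cycle_subG //= morphmE.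
Qed.

(** The two inverse maps given by [fhom_factor] force its intermediate subgroup to be the image of
    [f]. *)
Lemma fhom_image P Q f : fhom F P Q f ->
  exists2 R : {group gT}, f @: P = R & [/\ R \subset Q, fhom F P R f &
    exists2 g, fhom F R P g & {in P, cancel f g} /\ {in R, cancel g f}].
Proof.
move=> Ff; have [R sRQ [FfR [g Fg [fK gK]]]] := fhom_factor Ff.
exists R; last by split=> //; exists g.
apply/setP=> y; apply/imsetP/idP=> [[x Px ->] | Ry].
  exact: fhom_mem FfR Px.
by exists (g y); rewrite ?gK // (fhom_mem Fg Ry).
Qed.

(** Elements of [Aut P] are permutations of the whole type fixing everything outside [P], so [f] is
    replaced by [perm_in], which agrees with it on [P]. *)
Lemma fhom_AutF P f :
  fhom F P P f -> exists2 a, a \in AutF F P & {in P, a =1 f}.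
Proof.
move=> Ff; have [fM injf sfP] := fhom_Inj Ff.
have aE := perm_inE injf sfP; exists (perm_in injf sfP) => //.
rewrite inE; apply/andP; split; last by apply: fhom_ext Ff => x /aE->.
rewrite inE perm_in_on; apply/morphicP=> x y Px Py.
by rewrite !aE ?groupM // (morphicP fM).
Qed.

Lemma AutF_closed P a x : a \in AutF F P -> x \in P -> a x \in P.
Proof. by case/setIdP=> Aa _; apply: Aut_closed. Qed.

Lemma AutFM P a : a \in AutF F P -> {in P &, {morph a : x y / x * y}}.
Proof. by case/setIdP=> Aa _; apply/morphicP/Aut_morphic. Qed.

Lemma fconj_refl P : P \subset S -> fconj F P P.
Proof. by move=> sPS; exists id; [|exists id]; rewrite ?fhom_sub //. Qed.

Lemma fconj_trans P Q R : fconj F P Q -> fconj F Q R -> fconj F P R.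
Proof.
move=> [f Ff [f' Ff' [fK f'K]]] [g Fg [g' Fg' [gK g'K]]].
exists (g \o f); first exact: fhom_comp Ff Fg.
exists (f' \o g'); first exact: fhom_comp Fg' Ff'.
split=> x Dx /=; first by rewrite gK ?fK // (fhom_mem Ff Dx).
by rewrite f'K ?g'K // (fhom_mem Fg' Dx).
Qed.

(** A boolean form of conjugacy, needed to maximize over a conjugacy class: quantifying over finite
    functions makes it decidable, and surjectivity yields the inverse through [fhom_image]. *)
Lemma fconjP P Q :
  reflect (fconj F P Q)
    [exists f : {ffun gT -> gT}, fhom F P Q f && (f @: P == Q)].
Proof.
apply: (iffP existsP) => [[f /andP[Ff /eqP fP]] | [f Ff [g Fg [_ gK]]]].
  have [R fR [_ FfR [g Fg Kfg]]] := fhom_image Ff.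
  have <-: R = Q by apply/val_inj; rewrite /= -fR.
  by exists f => //; exists g.
have eff: {in P, f =1 [ffun x => f x]} by move=> x _; rewrite ffunE.
exists [ffun x => f x]; rewrite (fhom_ext eff Ff) /=; apply/eqP.
rewrite -(eq_in_imset eff); apply/setP=> y.
apply/imsetP/idP=> [[x Px ->] | Qy]; first exact: fhom_mem Ff Px.
by exists (g y); rewrite ?gK // (fhom_mem Fg Qy).
Qed.

Lemma exists_fully_centralized P :
  P \subset S -> exists2 T, fconj F P T & fully_centralized F T.
Proof.
move=> sPS; have /fconjP P0 := fconj_refl sPS.
pose cP (T : {group gT}) :=
  [exists f : {ffun gT -> gT}, fhom F P T f && (f @: P == T)].
case: (@arg_maxnP _ P cP (fun T => #|'C_S(T)|) P0) => T /fconjP PT maxT.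
exists T => //; split=> [|Q TQ]; first by have [f /fhom_obj[]] := PT.
by apply: maxT; apply/fconjP; apply: fconj_trans TQ.
Qed.

(** Conjugation by [x] is trivial on [P], so the identity of [AutS] is a witness. In particular the
    extension domain always contains the center of S. *)
Lemma mem_Nphi_cent P R f x : x \in 'C_S(P) -> x \in Nphi S P R f.
Proof.
move=> /setIP[Sx cPx].
rewrite in_set inE Sx (subsetP (cent_sub P)) //=.
apply/exists_inP; exists 1; first exact: group1.
apply/forall_inP=> y Py; rewrite perm1.
by rewrite /conjg -(centP cPx) // mulKg.
Qed.

(** For [x] in [P], [f] carries conjugation by [x] to conjugation by [f x]. *)
Lemma sub_Nphi P R f : fhom F P S f -> f @: P = R -> P \subset Nphi S P R f.
Proof.
move=> Ff fP; have [sPS _] := fhom_obj Ff; apply/subsetP=> x Px.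
have Rf y : y \in P -> f y \in R by rewrite -fP => Py; apply: imset_f.
have nRf: f x \in 'N(R) by apply: (subsetP (normG R)); apply: Rf.
rewrite in_set inE (subsetP sPS) // (subsetP (normG P)) //=.
apply/exists_inP; exists (conj_aut R (f x)).
  by rewrite mem_morphim // inE nRf (fhom_mem Ff Px).
apply/forall_inP=> y Py; rewrite norm_conj_autE ?Rf //.
apply/eqP/(mulgI (f x)); rewrite -(fhomM Ff) ?groupJ // -!conjgC.
by rewrite (fhomM Ff).
Qed.

End FusionSystemTheory.

(** * Saturated fusion systems with a central cyclic subgroup absorbing commutators and [m]-th
    powers *)

Section StableCentralSubgroup.

Variables (p m : nat) (gT : finGroupType) (S : {group gT}) (c : gT).
Variable F : fusion_system S.
Local Notation z := (c ^+ m).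
Local Notation W := <[c ^+ m]>.
Hypotheses (satF : saturated F p) (Zc : c \in 'Z(S)) (pz : p.-elt z).
Hypotheses (sS'W : S^`(1) \subset W) (SmW : {in S, forall s, s ^+ m \in W}).
Implicit Types (P Q R T : {group gT}) (f g : gT -> gT).

Let Sc : c \in S.
Proof. by case/setIP: Zc. Qed.

Let cSc s : s \in S -> commute s c.
Proof. by case/setIP: Zc => _ /centP Cc Ss; apply/commute_sym/Cc. Qed.

Let Sz : z \in S. Proof. exact: groupX. Qed.

Let cSW s w : s \in S -> w \in W -> commute s w.
Proof.
by move=> Ss /cycleP[i ->]; do 2!apply: commuteX; apply: cSc.
Qed.

(* The inverse of [f] on [<[f z]>] has the fully centralized image [W], so it *)
(* extends to a group containing [c], and it maps [z = c ^+ m] into [W].      *)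
Lemma fhom_stable_cycle Q R f : fhom F Q R f -> z \in Q -> <[f z]> = W.
Proof.
move=> Ff Qz; have [sQS sRS] := fhom_obj Ff.
have FfW: fhom F W S f.
  by apply: fhom_restr (fhom_widen sRS (subxx S) Ff); rewrite cycle_subG.
have [P fW [sPS _ [g Fg [fK gK]]]] := fhom_image FfW.
have defP: P = <[f z]>%G.
  by apply: val_inj; rewrite /= -fW (fhom_cycle FfW) ?cycle_id.
subst P; set y := f z in fW sPS Fg gK *.
have Sy: y \in S by rewrite -cycle_subG.
have gy: g y = z by rewrite fK ?cycle_id.
have sWS: W \subset S by rewrite cycle_subG.
have FgS := fhom_widen sWS (subxx S) Fg.
have gP: g @: <[y]> = <[z]>%G by rewrite (fhom_cycle Fg) ?cycle_id // gy.
have cW: fully_centralized F <[z]>.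
  split=> // P _; apply: subset_leq_card; rewrite subsetI subsetIl /=.
  apply/subsetP=> s /setIP[Ss _]; apply/centP=> w Ww; exact: cSW.
have [N defN [h Fh hg]] := satF.2 _ _ _ FgS gP cW.
have Nc s : s \in 'C_S(<[y]>) -> s \in N.
  by move=> Cs; rewrite -[N : {set _}]/(gval N) defN mem_Nphi_cent.
have cN : c \in N.
  apply: Nc; rewrite inE Sc; apply/centP=> u yu; apply/commute_sym/cSc.
  by apply: (subsetP sPS).
have Ny : y \in N.
  by apply: Nc; rewrite inE Sy -cycle_subG; apply: cycle_abelian.
have /cycleP[k hz] : h z \in <[h y]>.
  by rewrite (fhomX _ Fh) // (hg y) ?cycle_id // gy SmW // (fhom_mem Fh).
have zyk : z = y ^+ k.
  by apply: (fhom_inj Fh); rewrite ?groupX // hz (fhomX _ Fh).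
(* [W] lies in [<[y]>]; equality follows by orders, as the injective [f] maps [W] onto [<[y]>]. *)
apply/esym/eqP; rewrite eqEcard cycle_subG zyk mem_cycle /= -zyk -fW.
by rewrite card_in_imset //; apply: fhom_inj FfW.
Qed.

Lemma normal_of_mem_cycle Q : Q \subset S -> z \in Q -> Q <| S.
Proof.
move=> sQS Qz; apply: sub_der1_normal => //.
by apply: subset_trans sS'W _; rewrite cycle_subG.
Qed.

Lemma fhom_mem_cycle Q R f :
  fhom F Q R f -> z \in Q -> {in W, forall w, f w \in W}.
Proof.
move=> Ff Qz w Ww; rewrite -(fhom_stable_cycle Ff Qz) -(fhom_cycle Ff Qz).
exact: imset_f.
Qed.

(** For [z] in [R], this is the stabilizer in Aut_F(R) of the series 1 <= W <= R; triviality on R/W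
    is written without the quotient. *)
Definition stabW R : {set {perm gT}} :=
  [set a in AutF F R | [forall x in R, x^-1 * a x \in W]
                       && [forall w in W, a w == w]].

Lemma stabWP R a :
  reflect [/\ a \in AutF F R, {in R, forall x, x^-1 * a x \in W}
            & {in W, forall w, a w = w}]
    (a \in stabW R).
Proof.
rewrite [_ \in stabW R]in_set; apply: (iffP and3P) => [] [Fa aW aw]; split=> //.
- by move=> x Rx; apply: (forall_inP aW).
- by move=> w Ww; apply/eqP/(forall_inP aw).
- exact/forall_inP.
by apply/forall_inP=> w Ww; rewrite aw.
Qed.

Lemma stabW_group_set R : R \subset S -> group_set (stabW R).
Proof.
move=> sRS; have [F1 FM] := group_setP (AutF_group_set F sRS).
apply/group_setP; split=> [|a b].
  by apply/stabWP; split=> // x _; rewrite perm1 ?mulVg.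
case/stabWP=> Fa aW aw /stabWP[Fb bW bw]; apply/stabWP; split.
- exact: FM.
- move=> x Rx; rewrite permM -(mulKVg (a x) (b _)) mulgA groupM ?aW //.
  by rewrite bW // (AutF_closed Fa).
by move=> w Ww; rewrite permM aw ?bw.
Qed.

(** Since [a] fixes [W] pointwise, the displacement [x^-1 * a x] accumulates: the [n]-th iterate
    moves [x] by its [n]-th power. Hence the exponent divides the order of [z]. *)
Lemma stabW_pgroup R (sRS : R \subset S) :
  z \in R -> p.-group (group (stabW_group_set sRS)).
Proof.
move=> Rz; rewrite -pnat_exponent; apply: pnat_dvd pz.
have sWR: W \subset R by rewrite cycle_subG.
apply/exponentP=> a /stabWP[Fa aW aw].
have aX n : {in R, forall x, (a ^+ n) x = x * (x^-1 * a x) ^+ n}.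
  elim: n => [|n IHn] x Rx; first by rewrite perm1 mulg1.
  rewrite expgSr permM IHn // (AutFM Fa) // ?(subsetP sWR) ?groupX ?aW //.
  by rewrite (aw (_ ^+ n)) ?groupX ?aW // expgS !mulgA mulgV mul1g.
have Aa: a \in Aut R by case/setIdP: Fa.
apply: (@eq_Aut _ R) => [||x Rx]; rewrite ?groupX ?group1 //.
have /cycleP[i wi] := aW x Rx.
by rewrite aX // wi -expgM mulnC expgM expg_order expg1n mulg1 perm1.
Qed.

(** Both triviality conditions survive conjugation because [b] and its inverse, being morphisms of
    F, preserve [W]. *)
Lemma stabW_norm R (sRS : R \subset S) : z \in R ->
  group (stabW_group_set sRS) <| group (AutF_group_set F sRS).
Proof.
move=> Rz; apply/andP; split; first by apply/subsetP=> a /stabWP[].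
apply/normsP=> b Fb; apply/eqP; rewrite eqEcard cardJg leqnn andbT.
have Fb': fhom F R R b by case/setIdP: Fb.
have FVb: fhom F R R b^-1 by case/setIdP: (groupVr Fb).
apply/subsetP=> _ /imsetP[a /stabWP[Fa aW aw] ->]; apply/stabWP; split.
- exact: (@groupJ _ (group (AutF_group_set F sRS))).
- move=> x Rx; rewrite -[x](permKV b) permJ; set y := b^-1 x.
  have Ry: y \in R by apply: fhom_mem FVb Rx.
  have sWR: W \subset R by rewrite cycle_subG.
  rewrite -(mulKVg y (a y)) (AutFM Fb) ?(subsetP sWR _ (aW y Ry)) // mulKg.
  exact: fhom_mem_cycle Fb' Rz _ (aW y Ry).
move=> w Ww; rewrite -{1}[w](permKV b) permJ aw ?permKV //.
exact: fhom_mem_cycle FVb Rz _ Ww.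
Qed.

(** [R] is normal in S, hence fully normalized, so axiom (I) makes [AutS S R] a Sylow subgroup; it
    contains every normal p-subgroup of Aut_F(R). *)
Lemma stabW_sub_AutS R : R \subset S -> z \in R -> stabW R \subset AutS S R.
Proof.
move=> sRS Rz; have nRS: 'N_S(R) = S.
  by apply/setIidPl/normal_norm/normal_of_mem_cycle.
have [_ sylR]: fully_centralized F R /\ p.-Sylow(AutF F R) (AutS S R).
  apply: satF.1; split=> // T _.
  by rewrite nRS subset_leq_card ?subsetIl.
have := stabW_pgroup sRS Rz; have nV := stabW_norm sRS Rz.
by move/pcore_max/(_ nV)/subset_trans; apply;
  apply: (@pcore_sub_Hall _ _ (group _) (conj_aut R @* 'N_S(R))) sylR.
Qed.

Lemma fhom_extends_to_S Q f : fhom F Q S f -> z \in Q ->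
  exists2 a, a \in AutF F S & {in Q, f =1 a}.
Proof.
move=> Ff Qz; have [sQS _] := fhom_obj Ff.
have [R fQ [sRS FfR [g Fg [fK gK]]]] := fhom_image Ff.
have Rz: z \in R.
  (* [f] maps [W] onto itself, so [z] is a value of [f] on [Q]. *)
  have := fhom_stable_cycle Ff Qz; rewrite -(fhom_cycle Ff Qz).
  move=> /setP/(_ z); rewrite cycle_id => /imsetP[w Ww ->].
  by rewrite (fhom_mem FfR) // (subsetP _ _ Ww) // cycle_subG.
have sWQ: W \subset Q by rewrite cycle_subG.
have nQS := normal_of_mem_cycle sQS Qz; have nRS := normal_of_mem_cycle sRS Rz.
have cR: fully_centralized F R.
  have [] // : fully_centralized F R /\ p.-Sylow(AutF F R) (AutS S R).
  apply: satF.1; split=> // T _.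
  by rewrite (setIidPl (normal_norm nRS)) subset_leq_card ?subsetIl.
have [N defN [h Fh hf]] := satF.2 _ _ _ Ff fQ cR.
have sSN: S \subset N.
  apply/subsetP=> x Sx; rewrite defN in_set.
  rewrite (setIidPl (normal_norm nQS)) Sx /=.
  have Fx: fhom F Q Q (conjg^~ x).
    apply: fhom_HomS => //; exists x; split=> //.
    by rewrite (normsP (normal_norm nQS)).
  (* The witness is [f] c_x [f]^-1 on [R]. It lies in [stabW R]: modulo [W] because S' <= W and [f]
     preserves [W], and on [W] because [W] is central. *)
  have [a Fa aE] := fhom_AutF (fhom_comp (fhom_comp Fg Fx) FfR).
  apply/exists_inP; exists a; last first.
    by apply/forall_inP=> y Qy; rewrite aE ?(fhom_mem FfR) //= fK.
  apply: (subsetP (stabW_sub_AutS sRS Rz)); apply/stabWP; split=> //.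
    move=> u Ru; rewrite aE //= conjg_mulR.
    have Sgu: g u \in S by rewrite (subsetP sQS) ?(fhom_mem Fg).
    have Wgux: [~ g u, x] \in W by rewrite (subsetP sS'W) ?mem_commg.
    rewrite (fhomM Ff) ?(subsetP sWQ _ Wgux) ?(fhom_mem Fg) // gK // mulKg.
    exact: fhom_mem_cycle Ff Qz _ Wgux.
  move=> w Ww; have Rw: w \in R by rewrite (subsetP _ _ Ww) ?cycle_subG.
  rewrite aE //= conjgE -(cSW Sx) ?mulKg ?gK //.
  exact: fhom_mem_cycle Fg Rz _ Ww.
have [sNS _] := fhom_obj Fh.
have [a Fa aE] := fhom_AutF (fhom_restr sSN Fh).
by exists a => // x Qx; rewrite aE ?hf // (subsetP sQS).
Qed.

Lemma normalized_of_central_cycle : normalized_by_S F.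
Proof.
move=> Q Q' f Ff0; have [sQS sQ'S] := fhom_obj Ff0.
have Ff := fhom_widen sQ'S (subxx S) Ff0.
have [R fQ [sRS FfR [g Fg [fK gK]]]] := fhom_image Ff.
have [T QT cT] := exists_fully_centralized F sQS.
have RT : fconj F R T.
  by apply: fconj_trans QT; exists g => //; exists f.
(* Since [T] is fully centralized, axiom (II) extends [h] to a group containing C_S(P), hence [z];
   [fhom_extends_to_S] then applies. *)
have ext P h : P \subset S -> fhom F P T h -> h @: P = T ->
    exists2 a, a \in AutF F S & {in P, h =1 a}.
  move=> sPS Fh hP; have FhS := fhom_widen cT.1 (subxx S) Fh.
  have [N defN [h' Fh' h'h]] := satF.2 _ _ _ FhS hP cT.
  have CN: 'C_S(P) \subset N.
    by apply/subsetP=> x; rewrite defN; apply: mem_Nphi_cent.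
  have Nz: z \in N.
    apply: (subsetP CN); rewrite inE Sz; apply/centP=> x Px.
    by apply/commute_sym/cSW; rewrite ?cycle_id ?(subsetP sPS).
  have [a Fa aE] := fhom_extends_to_S Fh' Nz.
  exists a => // x Px; rewrite -h'h // aE // (subsetP _ _ Px) // defN.
  exact: sub_Nphi FhS hP.
have [t Ft [t' Ft' [tK t'K]]] := QT.
have tQ: t @: Q = T.
  apply/setP=> y; apply/imsetP/idP=> [[x Qx ->] | Ty].
    exact: fhom_mem Ft Qx.
  by exists (t' y); rewrite ?t'K ?(fhom_mem Ft').
have tgR: (t \o g) @: R = T.
  rewrite -fQ -imset_comp -tQ; apply: eq_in_imset => x Qx /=.
  by rewrite fK.
have [a Fa aE] := ext Q t sQS Ft tQ.
have [b Fb bE] := ext R _ sRS (fhom_comp Fg Ft) tgR.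
(* On [Q] the extension [a] of [t] equals [b] after [f], since [b] extends [t \o g] with [g] inverse
   to [f]; permutation products compose left to right. *)
exists (a * b^-1).
  pose A := group (AutF_group_set F (subxx S)).
  by rewrite -[AutF F S]/(gval A) groupMl ?groupV.
move=> x Qx; rewrite permM -aE //; apply: (canRL (permK b)).
by rewrite -bE ?(fhom_mem FfR) //= fK.
Qed.

End StableCentralSubgroup.

(** * The groups C(p,r) *)

Theorem theorem4p2 (p r : nat) (gT : finGroupType) (S : {group gT}) :
  prime p -> 3 <= p -> 3 < r ->
  S \isog Grp (a : b : c :
    (a ^+ p = 1, b ^+ p = 1, c ^+ (p ^ (r - 2))%N = 1,
     [~ a, b] = c ^+ (p ^ (r - 3))%N, [~ c, a] = 1, [~ c, b] = 1)) ->
  resistant p S.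
Proof.
move=> p_pr _ r_gt3 /isoGrp_hom/existsP[[[a b] c]] /=.
case/eqP=> defS ap bp cp ab ca cb.
pose m := (p ^ (r - 3))%N; rewrite -/m in ab.
(* This is where [3 < r] enters: [m] is a multiple of [p], so [c ^+ m] lies in [<[c ^+ p]>]. *)
have Dm : m = (p * p ^ (r - 4))%N by rewrite -expnS -subSn.
pose X := [set a; b; c].
have genX : <<X>> = S.
  by rewrite -defS /cycle !joing_idr [in RHS]joing_idl; apply/esym/joing_idl.
have Xa : a \in X by rewrite !inE eqxx.
have Xb : b \in X by rewrite !inE eqxx orbT.
have Xc : c \in X by rewrite !inE eqxx !orbT.
have Zc : c \in 'Z(S).
  rewrite inE -{1}genX mem_gen //= -sub_cent1 -genX gen_subG.
  apply/subsetP=> _ /setUP[/set2P[]|/set1P] -> //; apply/cent1P/commute_sym.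
  - exact/commgP/eqP.
  - exact/commgP/eqP.
  by [].
(* Used with [n = m] to bound the derived subgroup, and with [n = p] to see that S modulo
   [<[c ^+ p]>] is elementary abelian. *)
have abelX n : c ^+ m \in <[c ^+ n]> -> X \subset 'N(<[c ^+ n]>) /\
    abelian (X / <[c ^+ n]>).
  move=> Kab.
  have nKX : X \subset 'N(<[c ^+ n]>).
    rewrite (subset_trans (subset_gen X)) // genX cents_norm // centsC.
    by rewrite cycle_subG groupX //; case/setIP: Zc.
  split=> //; rewrite /abelian quotient_cents2 // gen_subG.
  have cc x : x \in X -> [~ c, x] = 1.
    by rewrite !inE -orbA => /or3P[]/eqP-> //; apply/eqP/commgP.
  have cc' x : x \in X -> [~ x, c] = 1.
    by move/cc=> cx; rewrite -invg_comm cx invg1.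
  apply/subsetP=> _ /imset2P[x y Xx Xy ->].
  move: (Xx) (Xy); rewrite !inE -!orbA => /or3P[]/eqP-> /or3P[]/eqP->;
    rewrite ?cc ?cc' ?commgg ?ab ?group1 //.
  by rewrite -invg_comm ab groupV.
have sS'W : S^`(1) \subset <[c ^+ m]>.
  have [nWX abX] := abelX m (cycle_id _).
  by rewrite der1_min // -genX ?gen_subG // quotient_gen // abelian_gen.
have SmW : {in S, forall s, s ^+ m \in <[c ^+ m]>}.
  have Kab: c ^+ m \in <[c ^+ p]> by rewrite Dm expgM mem_cycle.
  have [nKX abX] := abelX p Kab.
  move=> s Ss.
  have nKs : s \in 'N(<[c ^+ p]>).
    by apply: subsetP Ss; rewrite -genX gen_subG.
  have /cycleP[k sp] : s ^+ p \in <[c ^+ p]>.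
    apply: coset_idr; rewrite ?groupX // morphX //.
    apply: (exponentP (_ : exponent (S / <[c ^+ p]>) %| p));
      last exact: mem_quotient.
    rewrite -genX quotient_gen // abelian_exponent_gen //.
    apply/exponentP=> _ /morphimP[x nKx Xx ->]; rewrite -morphX //.
    move: Xx; rewrite !inE -orbA => /or3P[]/eqP->; rewrite ?ap ?bp ?morph1 //.
    exact/coset_id/cycle_id.
  (* From s^p = (c^p)^k, raising to the power p^(r-4) gives s^m = (c^m)^k. *)
  by rewrite Dm !expgM sp -(expgM _ k) mulnC expgM mem_cycle.
have zp : (c ^+ m) ^+ p = 1.
  by rewrite -expgM -expnSr -subSn 1?ltnW // subSS.
have pz : p.-elt (c ^+ m).
  by apply: pnat_dvd (_ : #[c ^+ m] %| p) (pnat_id p_pr); rewrite order_dvdn zp.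
split; last by move=> F satF; apply: normalized_of_central_cycle satF Zc pz _ _.
(* S is a p-group because its exponent divides [m * p]: s^m lies in [W], and z^p = 1. *)
rewrite -pnat_exponent; apply: (@pnat_dvd _ (m * p)).
  apply/exponentP=> s Ss; rewrite expgM.
  by have /cycleP[k ->] := SmW s Ss; rewrite -expgM mulnC expgM zp expg1n.
by rewrite -expnSr pnatX pnat_id.
Qed.
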